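(* Let $W$ be a modulus of continuity, let $u\in\mathcal{C}^2_W(\bar\Omega)$ be a solution of the peridynamic model $\partial^2_{tt}u=\mathcal{L}u$ on $\bar\Omega=[-1,1]\times[-1,1]$, $u(x,-1)=u_0(x)$, $\partial_tu(x,-1)=v_0(x)$ for $x\in[-1,1]$, and let $K\ge2$ be an integer. For $N\ge K$ let $\bar u^N=(\bar u^N_{nm})_{n,m=0}^N$ be a sequence of solutions of the system of inequalities $(S_N)$ (defined in the context), given by $$\bar u^N_{nm}=\tilde u_N(x_n,t_m),\qquad n,m=0,\dots,N,$$ $$\tilde u_N(x,t)=u(x,-1)+u_t(x,-1)(t+1)+\int_{-1}^t\int_{-1}^\tau p_N(x,s)\,ds\,d\tau,$$ where $p_N\in\mathcal{P}(N-2,N,\bar\Omega)$ is a polynomial satisfying $$\|u_{tt}-p_N\|_\infty\le\frac{L}{(2N-2)^2}\,W\!\left(\frac{1}{(2N-2)^2}\right)$$ for a constant $L>0$ independent of $N$. Let $u^N$, $N\ge K$, be the interpolating polynomial $$u^N(x,t)=\sum_{i=0}^N\sum_{j=0}^N\bar a^N_{ij}T_i(x)T_j(t),\qquad \bar a^N_{ij}=\frac{1}{\gamma_i\gamma_j}\sum_{n=0}^N\sum_{m=0}^N\bar u^N_{nm}T_i(x_n)T_j(t_m)w_nw_m.$$ Assume that the sequence $\{(u^N(\cdot,-1),u^N_t(\cdot,-1),u^N_{tt}(\cdot,\cdot))\}_{N=K}^\infty$ has a subsequence $\{(u^{N_i}(\cdot,-1),u^{N_i}_t(\cdot,-1),u^{N_i}_{tt}(\cdot,\cdot))\}_{i=0}^\infty$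 converging uniformly to $(\varphi_1,\varphi_2,\varphi_3)$ (the first two components uniformly on $[-1,1]$, the third uniformly on $\bar\Omega$), where $\varphi_1,\varphi_2\in\mathcal{C}^2([-1,1])$ and $\varphi_3\in\mathcal{C}^2(\bar\Omega)$. Then the limit $$U(x,t)=\lim_{i\to\infty}u^{N_i}(x,t),\qquad (x,t)\in\bar\Omega,$$ exists and $U$ is a solution of the peridynamic model, i.e. $\partial^2_{tt}U=\mathcal{L}U$ on $\bar\Omega$, $U(x,-1)=u_0(x)$ and $\partial_tU(x,-1)=v_0(x)$ for $x\in[-1,1]$.
   Context: **Peridynamic operator.** Fix a horizon $\delta>0$ and an even function $C\in L^\infty(\mathbb{R})$ (the micromodulus function) with $C(\xi)=0$ for $|\xi|>\delta$; put $\beta=\int_{\mathbb{R}}C(x)\,dx$. With pairwise force $f(\xi,\eta)=C(\xi)\eta^3$, the peridynamic operator is $$\mathcal{L}u(x,t)=(C\ast u^3)(x,t)-3u(x,t)(C\ast u^2)(x,t)+3u^2(x,t)(C\ast u)(x,t)-\beta u^3(x,t),$$ where $(C\ast g)(x,t)=\int_{\mathbb{R}}C(x-x')g(x',t)\,dx'$ is convolution in space; functions defined only for $x\in[-1,1]$ are extended by zero in $x$ inside the convolutions. **Modulus of continuity.** A continuous function $W:\mathbb{R}_+\to\mathbb{R}_+$ is a modulus of continuity if $W$ is increasing, $\lim_{z\to0}W(z)=0$, $W(z_1+z_2)\le W(z_1)+W(z_2)$ for $z_1,z_2\in\mathbb{R}_+$, and there is a constant $c>0$ with $z\le cW(z)$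 for all $0<z\le2$. **Function spaces.** Let $B^2$ be the unit ball in $\mathbb{R}^2$. A continuous function $g$ on $B^2$ admits $W$ as a modulus of continuity if $$|g|_W=\sup\left\{\frac{|g(P)-g(Q)|}{W(|||P-Q|||)}:P\neq Q\in B^2\right\}<\infty,$$ where $|||\cdot|||$ is the maximum norm on $\mathbb{R}^2$. $\mathcal{C}^k_W(B^2)$ is the class of $k$-times differentiable functions on $B^2$ whose $k$-th derivatives admit $W$ as a modulus of continuity. With $\bar\Omega=[-1,1]\times[-1,1]$, $\mathcal{C}^k_W(\bar\Omega)$ is the set of $u\in\mathcal{C}^k(\bar\Omega)$ such that for each point $P\in\bar\Omega$ there is a $C^\infty$ map $\phi:B^2\to\bar\Omega$ with $P\in\mathrm{int}(\phi(B^2))$ (interior relative to $\bar\Omega$) and $u\circ\phi\in\mathcal{C}^k_W(B^2)$. $\mathcal{P}(N-2,N,\bar\Omega)$ denotes the real polynomials in $(x,t)\in\bar\Omega$ of degree at most $N-2$ in $t$ and at most $N$ in $x$. $\|\cdot\|_\infty$ is the supremum norm on $\bar\Omega$. **Discretization.** $T_n(x)=\cos(n\arccos x)$ is the $n$-th Chebyshev polynomial of the first kind on $[-1,1]$. The Gauss–Lobatto nodes are $x_n=\cos(n\pi/N)$, $t_m=\cos(m\pi/N)$, $n,m=0,\dots,N$. Weights: $w_0=w_N=\frac{\pi}{2N}$, $w_n=\frac{\pi}{N}$ otherwise; $\gamma_0=\gamma_N=\pi$, $\gamma_n=\frac{\pi}{2}$ otherwise. Given nodal values $(u^N_{nm})_{n,m=0}^N$,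 their discrete Chebyshev coefficients are $u_{jk}=\frac{1}{\gamma_j\gamma_k}\sum_{n,m=0}^N u^N_{nm}T_j(x_n)T_k(t_m)w_nw_m$ and the associated polynomial is $\sum_{j,k=0}^N u_{jk}T_j(x)T_k(t)$. The $(N+1)\times(N+1)$ Chebyshev derivative matrix $D=(D_{nk})_{n,k=0}^N$ has entries $D_{nk}=2k/c_n$ if $k>n$ and $k+n$ is odd, and $D_{nk}=0$ otherwise, where $c_0=2$, $c_n=1$ for $n\ge1$. Put $\hat D=D\cdot D$ and $\hat u_{kj}=\sum_{\ell=0}^N\hat D_{k\ell}u_{j\ell}$. $\mathcal{L}(u^N_{nm},t_m)$ denotes the value at $(x_n,t_m)$ of the peridynamic operator applied to the associated polynomial. **System $(S_N)$** in the unknown nodal values $(u^N_{nm})_{n,m=0}^N$: $$\left|\sum_{j=0}^N\sum_{k=0}^N\hat u_{kj}T_j(x_n)T_k(t_m)-\mathcal{L}(u^N_{nm},t_m)\right|\le\frac{\sqrt N}{(2N-2)^2}W\!\left(\frac{1}{(2N-2)^2}\right),\quad n=0,\dots,N,\ m=1,\dots,N,$$ $$\left|\sum_{j=0}^N\sum_{k=0}^N(-1)^ku_{jk}T_j(x_n)-u_0(x_n)\right|\le\frac{\sqrt N}{(2N-2)^2}W\!\left(\frac{1}{(2N-2)^2}\right),\quad n=0,\dots,N,$$ $$\left|\sum_{j=0}^N\sum_{k=0}^N\sum_{\ell=0}^N(-1)^kD_{k\ell}u_{j\ell}T_j(x_n)-v_0(x_n)\right|\le0,\quad n=0,\dots,N.$$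 *)

(* Defs.v *)
From HB Require Import structures.
From mathcomp Require Import all_boot all_order all_algebra.
From mathcomp Require Import all_classical all_reals all_analysis.

Set Implicit Arguments.
Unset Strict Implicit.
Unset Printing Implicit Defensive.

Import Order.TTheory GRing.Theory Num.Theory.
Import numFieldNormedType.Exports.

Local Open Scope classical_set_scope.
Local Open Scope ring_scope.

(* A function g(x, t) is represented as a map g : R * R -> R with P = (x, t);
   on [-1, 1] and [-1, 1]^2 only the values there are meaningful.  The norm
   `|P| that the library puts on R * R is the maximum norm.                   *)

Definition I11 (R : realType) : set R := [set` `[-1, 1]].
Arguments I11 : clear implicits.

Definition Omega (R : realType) : set (R * R) := I11 R `*` I11 R.
Arguments Omega : clear implicits.

Definition B2 (R : realType) : set (R * R) := [set P | P.1 ^+ 2 + P.2 ^+ 2 <= 1].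
Arguments B2 : clear implicits.

Definition supnorm (R : realType) (g : R * R -> R) : \bar R :=
  ereal_sup [set (`|g P|)%:E | P in Omega R].

(* Derivatives of functions of one variable relative to [-1, 1]: the usual
   derivative at interior points, the one-sided one at -1 and at 1.           *)

Definition diff_quot (R : realType) (f : R -> R) (t s : R) : R :=
  (f s - f t) / (s - t).

Definition derivableI (R : realType) (f : R -> R) (t : R) : Prop :=
  cvg (diff_quot f t s @[s --> within (I11 R) t^']).

Definition dI (R : realType) (f : R -> R) (t : R) : R :=
  lim (diff_quot f t s @[s --> within (I11 R) t^']).

Definition dt (R : realType) (u : R * R -> R) (P : R * R) : R :=
  dI (fun s => u (P.1, s)) P.2.

Fixpoint CkI (R : realType) (k : nat) (f : R -> R) : Prop :=
  match k with
  | 0 => {within I11 R, continuous f}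
  | k'.+1 => (forall t, I11 R t -> derivableI f t) /\ CkI k' (dI f)
  end.

(* f is (Frechet) differentiable at every point of A, relative to A, with
   partial derivatives fx and ft.  When A is convex with nonempty interior
   (as B2 and Omega are), fx and ft are unique on A.                          *)
Definition gradient_on (R : realType) (A : set (R * R))
    (f fx ft : R * R -> R) : Prop :=
  forall P, A P ->
    (f Q - f P - fx P * (Q.1 - P.1) - ft P * (Q.2 - P.2)) / `|Q - P|
      @[Q --> within A P^'] --> (0 : R).

Fixpoint kth_partials (R : realType) (prop : (R * R -> R) -> Prop) (k : nat)
    (A : set (R * R)) (f : R * R -> R) : Prop :=
  match k with
  | 0 => prop f
  | k'.+1 => exists fx ft : R * R -> R,
      [/\ gradient_on A f fx ft,
          kth_partials prop k' A fx & kth_partials prop k' A ft]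
  end.

Definition Ck (R : realType) (k : nat) (A : set (R * R)) (f : R * R -> R) :
    Prop :=
  kth_partials (fun g => {within A, continuous g}) k A f.

Definition smooth_map (R : realType) (A : set (R * R)) (phi : R * R -> R * R) :
    Prop :=
  forall k, Ck k A (fun P => (phi P).1) /\ Ck k A (fun P => (phi P).2).

Definition modulus_of_continuity (R : realType) (W : R -> R) : Prop :=
  [/\ {within [set z : R | 0 <= z], continuous W} /\
        (forall z, 0 <= z -> 0 <= W z),
      (forall z1 z2, 0 <= z1 -> z1 <= z2 -> W z1 <= W z2),
      W z @[z --> 0^'+] --> (0 : R),
      (forall z1 z2, 0 <= z1 -> 0 <= z2 -> W (z1 + z2) <= W z1 + W z2) &
      exists2 c, 0 < c & forall z, 0 < z -> z <= 2 -> z <= c * W z].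

Definition modnorm (R : realType) (W : R -> R) (g : R * R -> R) : \bar R :=
  ereal_sup [set e | exists P Q, [/\ B2 R P, B2 R Q, P <> Q &
                       e = (`|g P - g Q| / W `|P - Q|)%:E]].

Definition admits_modulus (R : realType) (W : R -> R) (g : R * R -> R) : Prop :=
  {within B2 R, continuous g} /\ (modnorm W g < +oo)%E.

Definition CkW_B2 (R : realType) (W : R -> R) (k : nat) (g : R * R -> R) :
    Prop :=
  kth_partials (admits_modulus W) k (B2 R) g.

(* within (Omega R) (nbhs P) consists of the neighbourhoods of P relative to
   Omega R, so its membership says that P is in the relative interior.        *)
Definition CkW (R : realType) (W : R -> R) (k : nat) (u : R * R -> R) : Prop :=
  Ck k (Omega R) u /\
  forall P, Omega R P -> exists phi : R * R -> R * R,
    [/\ smooth_map (B2 R) phi,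
        phi @` B2 R `<=` Omega R,
        within (Omega R) (nbhs P) (phi @` B2 R) &
        CkW_B2 W k (u \o phi)].

Definition micromodulus (R : realType) (delta : R) (C : R -> R) : Prop :=
  [/\ (C : measurableTypeR R -> R) \in Lfun (@lebesgue_measure R) +oo%E,
      (forall xi, C (- xi) = C xi) &
      forall xi, delta < `|xi| -> C xi = 0].

(* g \_ I11 R is the extension by zero of g outside [-1, 1]. *)
Definition conv_integrand (R : realType) (C g : R -> R) (x : R) : R -> R :=
  fun y => C (x - y) * (g \_ (I11 R)) y.

Definition conv (R : realType) (C g : R -> R) (x : R) : R :=
  \int[@lebesgue_measure R]_y conv_integrand C g x y.

Definition conv_exists (R : realType) (C g : R -> R) (x : R) : Prop :=
  (@lebesgue_measure R).-integrable setT (EFin \o conv_integrand C g x).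

Definition periop (R : realType) (C : R -> R) (u : R * R -> R) (P : R * R) : R :=
  let: (x, t) := P in
  let beta := \int[@lebesgue_measure R]_y C y in
  conv C (fun y => u (y, t) ^+ 3) x
  - 3 * u (x, t) * conv C (fun y => u (y, t) ^+ 2) x
  + 3 * u (x, t) ^+ 2 * conv C (fun y => u (y, t)) x
  - beta * u (x, t) ^+ 3.

(* The integral conv is a total function of its integrand; the first clause
   makes sure that the convolutions in periop are genuine integrals.          *)
Definition peridynamic_solution (R : realType) (C u0 v0 : R -> R)
    (u : R * R -> R) : Prop :=
  [/\ (forall x t, I11 R x -> I11 R t -> forall k : nat, (1 <= k <= 3)%N ->
         conv_exists C (fun y => u (y, t) ^+ k) x),
      (forall x t, I11 R x -> I11 R t ->
         derivableI (fun s => u (x, s)) t /\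
         derivableI (fun s => dt u (x, s)) t),
      (forall P, Omega R P -> dt (dt u) P = periop C u P),
      (forall x, I11 R x -> u (x, -1) = u0 x) &
      (forall x, I11 R x -> dt u (x, -1) = v0 x)].

(* A polynomial in x and t is an element p of {poly {poly R}}, with outer
   indeterminate t and inner indeterminate x; poly_xt p is its value.         *)
Definition poly_xt (R : realType) (p : {poly {poly R}}) (P : R * R) : R :=
  p.[P.2%:P].[P.1].

Definition Pdeg (R : realType) (degt degx : nat) (p : {poly {poly R}}) : Prop :=
  (size p <= degt.+1)%N /\ (forall i : nat, (size (p`_i)%R <= degx.+1)%N).

Definition chebT (R : realType) (n : nat) (x : R) : R := cos (n%:R * acos x).

Definition node (R : realType) (N n : nat) : R := cos (n%:R * pi / N%:R).
Arguments node : clear implicits.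

Definition weight (R : realType) (N n : nat) : R :=
  if (n == 0)%N || (n == N) then pi / (2 * N%:R) else pi / N%:R.
Arguments weight : clear implicits.

Definition cgamma (R : realType) (N n : nat) : R :=
  if (n == 0)%N || (n == N) then pi else pi / 2.
Arguments cgamma : clear implicits.

Definition cheb_coef (R : realType) (N : nat) (v : 'M[R]_N.+1) : 'M[R]_N.+1 :=
  \matrix_(j, k) (1 / (cgamma R N j * cgamma R N k) *
    \sum_(n < N.+1) \sum_(m < N.+1)
      v n m * chebT j (node R N n) * chebT k (node R N m)
      * weight R N n * weight R N m).

Definition assoc_poly (R : realType) (N : nat) (v : 'M[R]_N.+1) (P : R * R) : R :=
  \sum_(j < N.+1) \sum_(k < N.+1) cheb_coef v j k * chebT j P.1 * chebT k P.2.

Definition chebD (R : realType) (N : nat) : 'M[R]_N.+1 :=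
  \matrix_(n, k) (if (n < k)%N && odd (k + n)
                  then (2 * k%:R) / (if (n == 0 :> nat)%N then 2 else 1)
                  else 0).
Arguments chebD : clear implicits.

(* Indexed as in \hat u_{kj}: first the t-index k, then the x-index j. *)
Definition uhat (R : realType) (N : nat) (v : 'M[R]_N.+1) : 'M[R]_N.+1 :=
  \matrix_(k, j) \sum_(l < N.+1) (chebD R N *m chebD R N) k l * cheb_coef v j l.

Definition rate (R : realType) (c : R) (W : R -> R) (N : nat) : R :=
  c / (2 * N%:R - 2) ^+ 2 * W (1 / (2 * N%:R - 2) ^+ 2).

Definition system_S (R : realType) (W C u0 v0 : R -> R) (N : nat)
    (v : 'M[R]_N.+1) : Prop :=
  [/\ (forall n m : 'I_N.+1, (0 < m)%N ->
         `|\sum_(j < N.+1) \sum_(k < N.+1)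
             uhat v k j * chebT j (node R N n) * chebT k (node R N m)
           - periop C (assoc_poly v) (node R N n, node R N m)|
         <= rate (Num.sqrt N%:R) W N),
      (forall n : 'I_N.+1,
         `|\sum_(j < N.+1) \sum_(k < N.+1)
             (-1) ^+ k * cheb_coef v j k * chebT j (node R N n)
           - u0 (node R N n)|
         <= rate (Num.sqrt N%:R) W N) &
      (forall n : 'I_N.+1,
         `|\sum_(j < N.+1) \sum_(k < N.+1) \sum_(l < N.+1)
             (-1) ^+ k * chebD R N k l * cheb_coef v j l * chebT j (node R N n)
           - v0 (node R N n)|
         <= 0)].

Definition utilde (R : realType) (u : R * R -> R) (p : {poly {poly R}})
    (P : R * R) : R :=
  let: (x, t) := P in
  u (x, -1) + dt u (x, -1) * (t + 1)
  + \int[@lebesgue_measure R]_(tau in [set` `[-1, t]])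
      \int[@lebesgue_measure R]_(s in [set` `[-1, tau]]) poly_xt p (x, s).

(* Main.v *)
Require Import Defs.
From HB Require Import structures.
From mathcomp Require Import all_boot all_order all_algebra.
From mathcomp Require Import all_classical all_reals all_analysis.
From mathcomp Require Import ring lra zify.
Set Implicit Arguments.
Unset Strict Implicit.
Unset Printing Implicit Defensive.

Import Order.TTheory GRing.Theory Num.Theory.
Import numFieldNormedType.Exports.
Local Open Scope classical_set_scope.
Local Open Scope ring_scope.

(** Why the theorem holds.  The limit U is the given solution u, and the model
    sees only values on Omega ([peridynamic_solution_ext]), so U solves it.

    The polynomials u^(N_i) are uniformly Cauchy on Omega.  Indeed, for a
    function f that is twice differentiable in t, the mean value inequality
    applied twice gives
      |f (x, t)| <= |f (x, -1)| + 2 |f_t (x, -1)| + 4 sup |f_tt (x, .)|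
    ([has_dI2_bound]), and for the difference of two polynomials of the
    sequence the right-hand side is small by the three uniform convergences
    ([assoc_poly_cauchy]).

    Their limit is found at the nodes.  By the discrete orthogonality of the
    Chebyshev polynomials, u^N interpolates the nodal values ubar^N
    ([assoc_poly_node]), that is, the values of utilde_N.  The function
    utilde_N shares with u its value and its time derivative at t = -1, and
    its second time derivative p_N is within rate L W N of u_tt; by the same
    estimate, utilde_N is within 4 rate L W N of u ([utilde_approx]), and this
    tends to 0 ([rate_cvg0]).

    The nodes become dense in Omega ([node_dense]), and u and each u^N are
    continuous there; so closeness at the nodes and the Cauchy property give
    u^(N_i) -> u at every point of Omega.                                     *)

(** * Derivatives relative to [-1, 1] *)

Lemma I11P (R : realType) (t : R) : I11 R t <-> -1 <= t <= 1.
Proof. by rewrite /I11 /= in_itv. Qed.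

(** The relational form of [dI]: it carries the existence of the derivative
    together with its values, so it is stable under linear operations and
    under changing the functions off [-1, 1].                                 *)
Definition has_dI (R : realType) (f df : R -> R) : Prop :=
  forall t, I11 R t -> diff_quot f t s @[s --> within (I11 R) t^'] --> df t.

Lemma within_I11_proper (R : realType) (t : R) :
  I11 R t -> ProperFilter (within (I11 R) t^').
Proof.
move=> /I11P /andP[t1 t2]; apply: Build_ProperFilter_ex => A.
move=> /nbhs_ballP [e /= e0 H].
have m0 : 0 < Num.min (e / 2) 1 by rewrite lt_min ltr01 divr_gt0.
have me : Num.min (e / 2) 1 < e.
  by rewrite gt_min ltr_pdivrMr// ltr_pMr// ltr1n.
have m1 : Num.min (e / 2) 1 <= 1 by rewrite ge_min lexx orbT.
move: (Num.min (e / 2) 1) m0 me m1 => m m0 me m1.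
have [t0|t0] := leP t 0.
  exists (t + m); apply: H.
  - by rewrite /ball /= opprD addrA subrr sub0r normrN gtr0_norm.
  - by apply/eqP; lra.
  - by apply/I11P; lra.
exists (t - m); apply: H.
- by rewrite /ball /= opprB addrC subrK gtr0_norm.
- by apply/eqP; lra.
- by apply/I11P; lra.
Qed.

Lemma cvg_diff_quotP (R : realType) (f : R -> R) (t l : R) :
  diff_quot f t s @[s --> within (I11 R) t^'] --> l <->
  forall e, 0 < e -> \forall s \near t,
    I11 R s -> s != t -> `|l - diff_quot f t s| <= e.
Proof.
rewrite cvgrPdist_le; split=> H e /H; rewrite near_withinE /dnbhs near_withinE.
  by apply: filterS => s + Is st; apply.
by apply: filterS => s + st Is; apply.
Qed.

Lemma has_dI_uniq (R : realType) (f df : R -> R) (t : R) :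
  has_dI f df -> I11 R t -> dI f t = df t.
Proof.
move=> H It; have := within_I11_proper It.
by move=> PF; apply: cvg_lim => //; exact: H.
Qed.

Lemma derivableI_has_dI (R : realType) (f : R -> R) :
  (forall t, I11 R t -> derivableI f t) -> has_dI f (dI f).
Proof. by move=> H t It; exact: H. Qed.

Lemma has_dI_derivableI (R : realType) (f df : R -> R) (t : R) :
  has_dI f df -> I11 R t -> derivableI f t.
Proof. by move=> H It; apply/cvg_ex; exists (df t); exact: H. Qed.

Lemma eq_has_dI (R : realType) (f g df dg : R -> R) :
  (forall t, I11 R t -> f t = g t) -> (forall t, I11 R t -> df t = dg t) ->
  has_dI f df -> has_dI g dg.
Proof.
move=> fg dfg H t It; apply/cvg_diff_quotP => e e0.
have /cvg_diff_quotP/(_ e e0) := H t It.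
apply: filterS => s + Is st; rewrite /diff_quot -!fg// -dfg//.
exact.
Qed.

Lemma has_dIB (R : realType) (f g df dg : R -> R) :
  has_dI f df -> has_dI g dg ->
  has_dI (fun t => f t - g t) (fun t => df t - dg t).
Proof.
move=> Hf Hg t It.
have -> : diff_quot (fun t => f t - g t) t =
    (fun s => diff_quot f t s - diff_quot g t s).
  by apply/funext => s; rewrite /diff_quot -mulrBl; congr (_ / _); ring.
by apply: cvgB; [exact: Hf|exact: Hg].
Qed.

(** The difference quotient of p at t is the cofactor q of 'X - t in
    p - p(t), a polynomial; so its limit is q(t), which is p'(t).             *)
Lemma has_dI_horner (R : realType) (p : {poly R}) :
  has_dI (horner p) (horner p^`()).
Proof.
move=> t It; apply/cvg_diff_quotP => e e0.
have [q pq] : exists q : {poly R}, p - p.[t]%:P = q * ('X - t%:P).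
  apply/factor_theorem; rewrite /root !hornerE subrr//.
have dq (s : R) : s != t -> diff_quot (horner p) t s = q.[s].
  move=> st; rewrite /diff_quot.
  have := congr1 (horner^~ s) pq; rewrite !hornerE => ->.
  by rewrite mulfK// subr_eq0.
have qt : p^`().[t] = q.[t].
  have := congr1 (fun r => r^`().[t]) pq.
  by rewrite derivB derivC subr0 derivM derivXsubC !hornerE subrr => ->; ring.
have /cvgrPdist_le/(_ e e0) := @continuous_horner R q t.
by apply: filterS => s ? _ st; rewrite dq// qt.
Qed.

Lemma has_dI_continuous (R : realType) (f df : R -> R) :
  has_dI f df -> {within I11 R, continuous f}.
Proof.
move=> H; apply/subspace_continuousP => t It.
apply/cvgrPdist_le => e e0; rewrite near_withinE.
have /cvg_diff_quotP/(_ _ ltr01) := H t It.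
have M0 : 0 < `|df t| + 1 by rewrite ltr_wpDl.
have : \forall s \near t, `|t - s| <= e / (`|df t| + 1).
  by apply: (@cvgr_dist_le _ _ _ (nbhs t) _ id) => //; rewrite divr_gt0.
apply: filterS2 => s ts ds Is.
have [->|st] := eqVneq s t; first by rewrite subrr normr0 ltW.
have {}ds := ds Is st.
have dle : `|diff_quot f t s| <= `|df t| + 1.
  rewrite -[diff_quot f t s](subKr (df t)) (le_trans (ler_normB _ _))//.
  by rewrite lerD2l.
have -> : f t - f s = diff_quot f t s * (t - s).
  rewrite /diff_quot -[t - s]opprB mulrN divfK ?subr_eq0//; ring.
rewrite normrM (le_trans (ler_pM _ _ dle ts))//.
by rewrite mulrC divfK// gt_eqF.
Qed.

Lemma has_dI_is_derive (R : realType) (f df : R -> R) (t : R) :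
  has_dI f df -> t \in `](-1), 1[ -> is_derive t 1 f (df t).
Proof.
move=> H tI.
have It : I11 R t by rewrite /I11 /=; exact: subset_itv_oo_cc tI.
suff D : (fun h => h^-1 *: (f (h *: 1 + t) - f t)) @ 0^' --> df t.
  by split; [apply/cvg_ex; exists (df t)|apply: cvg_lim].
apply/cvgrPdist_le => e e0; rewrite /dnbhs near_withinE.
have /cvg_diff_quotP/(_ _ e0) := H t It.
have : \forall s \near t, I11 R s.
  have : \forall s \near t, s \in `](-1 : R), 1[ by exact: near_in_itvoo.
  by apply: filterS => s; rewrite /I11 /=; exact: subset_itv_oo_cc.
move=> I D.
have {I D} : \forall s \near t, s != t -> `|df t - diff_quot f t s| <= e.
  by apply: filterS2 I D => s Is; apply.
rewrite (near_shift 0); apply: filterS => h /=.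
rewrite subr0 /diff_quot scaler1 => + h0.
have -> : (h + t != t) by rewrite -subr_eq0 addrK.
rewrite addrK => /(_ isT).
by rewrite mulrC.
Qed.

Lemma has_dI_lipschitz (R : realType) (f df : R -> R) (M : R) :
  has_dI f df -> (forall t, I11 R t -> `|df t| <= M) ->
  forall t, I11 R t -> `|f t| <= `|f (-1)| + 2 * M.
Proof.
move=> H dM t It; have /I11P /andP[t1 t2] := It.
have M0 : 0 <= M by exact: le_trans (normr_ge0 _) (dM t It).
have sub : `[-1, t] `<=` I11 R.
  by move=> s /=; rewrite in_itv /= => /andP[? st]; apply/I11P; lra.
have [|s st||c cI fE] := @MVT_segment R f df (-1) t => //.
- apply: has_dI_is_derive => //; move: st; rewrite !in_itv /= => /andP[? ?].
  lra.
- exact: continuous_subspaceW sub (has_dI_continuous H).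
have Ic : I11 R c by exact: sub.
rewrite -[f t](subrK (f (-1))) fE addrC (le_trans (ler_normD _ _))// lerD2l.
rewrite normrM mulrC ler_pM// ?dM// ger0_norm; lra.
Qed.

(** This is the estimate that turns convergence of second time derivatives
    into convergence of the functions: the mean value inequality on an
    interval of length 2, applied to df and then to f.                        *)
Lemma has_dI2_bound (R : realType) (f df ddf : R -> R) (M : R) :
  has_dI f df -> has_dI df ddf -> (forall t, I11 R t -> `|ddf t| <= M) ->
  forall t, I11 R t -> `|f t| <= `|f (-1)| + 2 * `|df (-1)| + 4 * M.
Proof.
move=> H1 H2 HM t It.
have := has_dI_lipschitz H1 (has_dI_lipschitz H2 HM) It.
lra.
Qed.

(** * Chebyshev interpolation at the Gauss-Lobatto nodes *)

(** T_(n+2) = 2 X T_(n+1) - T_n, by the addition formulas for the cosine.  The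
    restriction to [-1, 1] is essential, since acos is arbitrary elsewhere.   *)
Lemma chebT_horner (R : realType) :
  exists T : nat -> {poly R}, forall n x, I11 R x -> chebT n x = (T n).[x].
Proof.
suff /choice[T HT] : forall n, exists p : {poly R},
    forall x, I11 R x -> chebT n x = p.[x] by exists T.
move=> n; suff [p [_ [Hp _]]] : exists p q : {poly R},
    (forall x, I11 R x -> chebT n x = p.[x]) /\
    (forall x, I11 R x -> chebT n.+1 x = q.[x]) by exists p.
elim: n => [|n [p [q [Hp Hq]]]].
  exists 1, 'X; split=> x Ix; rewrite hornerE /chebT ?mul0r ?cos0// mul1r.
  by apply: acosK.
exists q, (2%:P * 'X * q - p); split=> // x Ix.
rewrite !hornerE -Hp// -Hq// /chebT.
set a := acos x; have -> : x = cos a by rewrite /a acosK.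
have -> : n.+2%:R * a = n.+1%:R * a + a by rewrite -!natr1; ring.
have -> : n%:R * a = n.+1%:R * a - a by rewrite -!natr1; ring.
by rewrite cosD cosB; ring.
Qed.

Lemma chebT_node (R : realType) (N j n : nat) : (0 < N)%N -> (n <= N)%N ->
  chebT j (node R N n) = cos (j%:R * (n%:R * pi / N%:R)).
Proof.
move=> N0 nN; rewrite /chebT /node cosK//.
have N0' : 0 < N%:R :> R by rewrite ltr0n.
rewrite in_itv /= divr_ge0 ?mulr_ge0 ?pi_ge0//=.
by rewrite ler_pdivrMr// mulrC ler_wpM2l ?pi_ge0// ler_nat.
Qed.

Lemma sin_natpi (R : realType) (k : nat) : sin (k%:R * pi : R) = 0.
Proof.
elim: k => [|k IH]; first by rewrite mul0r sin0.
by rewrite -natr1 mulrDl mul1r sinDpi IH oppr0.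
Qed.

Lemma cos_nat2pi (R : realType) (k : nat) : cos (k%:R * (2 * pi) : R) = 1.
Proof.
elim: k => [|k IH]; first by rewrite mul0r cos0.
by rewrite -natr1 mulrDl mul1r [X in _ + X]mulr_natl cosD2pi.
Qed.

(** The sum telescopes: with b = 2aj, both sides grow by
    2 sin a cos a cos (b + a) when j is added.                                *)
Lemma trapezoid_cos (R : realType) (a : R) (M : nat) :
  sin a * \sum_(j < M) (cos (j%:R * (2 * a)) + cos (j.+1%:R * (2 * a))) =
  cos a * sin (M%:R * (2 * a)).
Proof.
elim: M => [|M IH]; first by rewrite big_ord0 mul0r sin0 !mulr0.
rewrite big_ord_recr /= mulrDr IH -[M.+1%:R]natr1.
have -> : (M%:R + 1) * (2 * a) = M%:R * (2 * a) + (a + a) by ring.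
move: (M%:R * (2 * a)) => b; rewrite !cosD !sinD !cosD.
have := cos2Dsin2 a; move: (cos a) (sin a) (cos b) (sin b) => c s x y cs.
(* The identity holds up to a multiple of cos^2 a + sin^2 a - 1. *)
suff : (s * (x + (x * (c * c - s * s) - y * (s * c + c * s)))
   + c * y - c * (y * (c * c - s * s) + x * (s * c + c * s))) =
   (c ^+ 2 + s ^+ 2 - 1) * (- s * x - c * y).
  by rewrite cs subrr mul0r; lra.
ring.
Qed.

(** The Gauss-Lobatto weights are those of the trapezoidal rule in the angle. *)
Lemma weight_sum (R : realType) (N : nat) (g : nat -> R) : (0 < N)%N ->
  \sum_(j < N.+1) weight R N j * g j =
  pi / (2 * N%:R) * \sum_(j < N) (g j + g j.+1).
Proof.
case: N => // M _; rewrite big_split /=.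
rewrite [X in _ * (X + _)]big_ord_recl [X in _ * (_ + X)]big_ord_recr /=.
rewrite big_ord_recl big_ord_recr /= /bump /= /weight /= eqxx.
under eq_bigr => i _ do rewrite add1n eqSS (ltn_eqF (ltn_ord i)).
under [X in _ = _ * (_ + X + _)]eq_bigr => i _ do rewrite add1n.
rewrite -mulr_sumr add1n.
have : M.+1%:R != 0 :> R by rewrite pnatr_eq0.
by move: (M.+1%:R) => x x0; field.
Qed.

(** In [trapezoid_cos] take a = k pi / (2N): then sin (2Na) = sin (k pi) = 0,
    and sin a can be cancelled because 0 < a < pi.                            *)
Lemma weight_cos_eq0 (R : realType) (N k : nat) : (0 < k)%N -> (k < 2 * N)%N ->
  \sum_(j < N.+1) weight R N j * cos (j%:R * (k%:R * pi / N%:R)) = 0.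
Proof.
move=> k0 kN; have N0 : (0 < N)%N by case: N kN.
rewrite (weight_sum (fun j => cos (j%:R * (k%:R * pi / N%:R))))//.
have N0' : 0 < N%:R :> R by rewrite ltr0n.
pose a : R := k%:R * pi / (2 * N%:R).
have aE : k%:R * pi / N%:R = 2 * a by rewrite /a; field; rewrite gt_eqF.
have s0 : 0 < sin a.
  apply: sin_gt0_pi; rewrite /a divr_gt0 ?mulr_gt0 ?pi_gt0 ?ltr0n//=.
  rewrite ltr_pdivrMr ?mulr_gt0// mulrC ltr_pM2l ?pi_gt0//.
  by rewrite -natrM ltr_nat.
rewrite aE; have := trapezoid_cos a N.
rewrite -aE [N%:R * _](_ : _ = k%:R * pi); last by field; rewrite gt_eqF.
rewrite sin_natpi mulr0 => /eqP; rewrite mulf_eq0 gt_eqF//= => /eqP E.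
by rewrite E mulr0.
Qed.

Lemma weight_sum1 (R : realType) (N : nat) : (0 < N)%N ->
  \sum_(j < N.+1) weight R N j = pi.
Proof.
move=> N0; under eq_bigr do rewrite -[weight _ _ _]mulr1.
rewrite (weight_sum (fun=> 1))// sumr_const card_ord -mulr_natl.
by field; rewrite pnatr_eq0 -lt0n.
Qed.

(** The product of cosines is half the sum of the cosines of frequencies n - a
    and n + a, which [weight_cos_eq0] annihilates unless the frequency is 0 or
    2N.  For n = a the frequency n + a is 0 or 2N exactly at n = 0 and n = N,
    whence the doubled value of cgamma at both ends.                          *)
Lemma weight_cos_cos (R : realType) (N n a : nat) :
  (0 < N)%N -> (n <= N)%N -> (a <= N)%N ->
  \sum_(j < N.+1) weight R N j *
    (cos (j%:R * (n%:R * pi / N%:R)) * cos (j%:R * (a%:R * pi / N%:R))) =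
  (n == a)%:R * cgamma R N n.
Proof.
wlog an : n a / (a <= n)%N.
  move=> H N0 nN aN; have [an|/ltnW na] := leqP a n; first exact: H.
  under eq_bigr do rewrite [X in _ * X]mulrC.
  by rewrite H// eq_sym; case: eqP => [->|]; rewrite ?mul0r.
move=> N0 nN aN.
have N0' : N%:R != 0 :> R by rewrite pnatr_eq0 -lt0n.
transitivity (2^-1 * \sum_(j < N.+1) weight R N j *
      cos (j%:R * ((n - a)%:R * pi / N%:R)) +
    2^-1 * \sum_(j < N.+1) weight R N j *
      cos (j%:R * ((n + a)%:R * pi / N%:R))).
  rewrite !mulr_sumr -big_split; apply: eq_bigr => j _ /=.
  have -> : j%:R * ((n - a)%:R * pi / N%:R) =
      j%:R * (n%:R * pi / N%:R) - j%:R * (a%:R * pi / N%:R) :> R.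
    by rewrite natrB//; ring.
  have -> : j%:R * ((n + a)%:R * pi / N%:R) =
      j%:R * (n%:R * pi / N%:R) + j%:R * (a%:R * pi / N%:R) :> R.
    by rewrite natrD; ring.
  by rewrite cosB cosD; field.
have [<-|/eqP na] := eqVneq n a; last first.
  have {}an : (a < n)%N by rewrite ltn_neqAle an andbT; apply/eqP => /esym.
  by rewrite !weight_cos_eq0 ?mulr0 ?mul0r ?addr0//; lia.
rewrite subnn mul1r /cgamma.
under eq_bigr do rewrite !mul0r mulr0 cos0 mulr1.
rewrite weight_sum1//.
have [->|n0] := eqVneq n 0%N => /=.
  under eq_bigr do rewrite !mul0r mulr0 cos0 mulr1.
  by rewrite weight_sum1//; field.
have [->|nN'] := eqVneq n N => /=.
  rewrite addnn -mul2n natrM.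
  have -> : 2 * N%:R * pi / N%:R = 2 * pi :> R by field.
  under eq_bigr do rewrite cos_nat2pi mulr1.
  by rewrite weight_sum1//; field.
by rewrite weight_cos_eq0 ?mulr0 ?addr0; [rewrite mulrC|lia|lia].
Qed.

(** T_j(x_n) = cos (j n pi / N) is symmetric in j and n, and 1 / gamma_j is a
    constant multiple of the weight w_j; so orthogonality over the degrees is
    the same identity as orthogonality over the nodes.                        *)
Lemma cheb_dual_orthogonality (R : realType) (N : nat) (n a : 'I_N.+1) :
  (0 < N)%N ->
  \sum_(j < N.+1) weight R N n / cgamma R N j *
    (chebT j (node R N n) * chebT j (node R N a)) = (n == a)%:R.
Proof.
move=> N0; have N0' : N%:R != 0 :> R by rewrite pnatr_eq0 -lt0n.
have pi0 : pi != 0 :> R by rewrite gt_eqF// pi_gt0.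
have invg (j : nat) : (cgamma R N j)^-1 = 2 * N%:R / pi ^+ 2 * weight R N j.
  rewrite /cgamma /weight; move: (@pi R) pi0 => x x0.
  by case: ifP => _; field; rewrite x0 N0'.
transitivity (weight R N n * (2 * N%:R / pi ^+ 2) * ((n == a)%:R * cgamma R N n)).
  rewrite -(weight_cos_cos R N0 (leq_ord n) (leq_ord a)) mulr_sumr.
  apply: eq_bigr => j _; rewrite invg !chebT_node ?leq_ord//; ring.
have [_|_] := eqVneq n a; last by rewrite mul0r mulr0.
rewrite mul1r [RHS]/= /cgamma /weight; move: (@pi R) pi0 => x x0.
by case: ifP => _; field; rewrite x0 N0'.
Qed.

(** The discrete Chebyshev transform is inverted by evaluation at the nodes:
    after exchanging the sums, each variable contributes one factor of
    [cheb_dual_orthogonality].                                                *)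
Lemma assoc_poly_node (R : realType) (N : nat) (v : 'M[R]_N.+1)
    (a b : 'I_N.+1) : (0 < N)%N ->
  assoc_poly v (node R N a, node R N b) = v a b.
Proof.
move=> N0; pose F (n a j : 'I_N.+1) := weight R N n / cgamma R N j *
  (chebT j (node R N n) * chebT j (node R N a)).
transitivity (\sum_(n < N.+1) \sum_(m < N.+1) v n m *
    ((\sum_j F n a j) * (\sum_k F m b k))).
  rewrite /assoc_poly.
  under eq_bigr => j _ do under eq_bigr => k _ do
    rewrite mxE mulr_sumr !mulr_suml.
  under eq_bigr => j _ do rewrite exchange_big /=.
  rewrite exchange_big; apply: eq_bigr => n _.
  under eq_bigr => j _ do under eq_bigr => k _ do
    rewrite mulr_sumr !mulr_suml.
  under eq_bigr => j _ do rewrite exchange_big /=.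
  rewrite exchange_big; apply: eq_bigr => m _.
  rewrite big_distrlr mulr_sumr; apply: eq_bigr => j _.
  rewrite mulr_sumr; apply: eq_bigr => k _.
  rewrite /F mul1r invfM /=; ring.
under eq_bigr => n _ do under eq_bigr => m _ do
  rewrite /F !cheb_dual_orthogonality//.
rewrite (bigD1 a)//= (bigD1 b)//= !eqxx !mulr1 big1 => [|m /negPf ->].
  rewrite big1 ?addr0// => n /negPf ->.
  by rewrite big1// => m _; rewrite mul0r mulr0.
by rewrite !mulr0.
Qed.

(** * Continuity and density *)

Lemma within_continuous_dist (R : realType) (A : set (R * R))
    (f : R * R -> R) (P : R * R) (e : R) :
  {within A, continuous f} -> A P -> 0 < e ->
  exists2 d : R, 0 < d & forall Q, A Q -> `|P - Q| < d -> `|f P - f Q| <= e.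
Proof.
move=> /subspace_continuousP cf AP e0.
have /cvgrPdist_le/(_ e e0) := cf P AP.
rewrite near_withinE => /nbhs_normP[d /= d0 H].
by exists d => // Q AQ PQ; exact: H.
Qed.

(** Near P the remainder is at most |Q - P|, so f grows from P at most like
    (1 + |fx P| + |ft P|) |Q - P|.                                            *)
Lemma gradient_on_continuous (R : realType) (A : set (R * R))
    (f fx ft : R * R -> R) :
  gradient_on A f fx ft -> {within A, continuous f}.
Proof.
move=> H; apply/subspace_continuousP => P AP.
apply/cvgrPdist_le => e e0; rewrite near_withinE.
have /cvgrPdist_le/(_ _ ltr01) := H P AP.
rewrite near_withinE /dnbhs near_withinE.
have M0 : 0 < 1 + `|fx P| + `|ft P| by rewrite !ltr_pwDl.
have : \forall Q \near P, `|P - Q| <= e / (1 + `|fx P| + `|ft P|).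
  by apply: (@cvgr_dist_le _ _ _ (nbhs P) _ id) => //; rewrite divr_gt0.
apply: filterS2 => Q PQ dQ AQ.
have [->|QP] := eqVneq Q P; first by rewrite subrr normr0 ltW.
have {}dQ := dQ QP AQ.
have n0 : 0 < `|Q - P| by rewrite normr_gt0 subr_eq0.
rewrite sub0r normrN normrM normfV normr_id ler_pdivrMr// mul1r in dQ.
have n1 : `|Q.1 - P.1| <= `|Q - P| by rewrite [leRHS]/Num.norm /= le_max lexx.
have n2 : `|Q.2 - P.2| <= `|Q - P|.
  by rewrite [leRHS]/Num.norm /= le_max lexx orbT.
rewrite distrC ler_pdivlMr// in PQ.
apply: le_trans PQ; rewrite /from_subspace [leLHS]distrC.
have -> : f Q - f P = (f Q - f P - fx P * (Q.1 - P.1) - ft P * (Q.2 - P.2)) +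
   fx P * (Q.1 - P.1) + ft P * (Q.2 - P.2) by ring.
apply: le_trans (ler_normD _ _) _.
apply: le_trans (lerD (ler_normD _ _) (lexx _)) _.
rewrite !normrM [leRHS](_ : _ = `|Q - P| + `|Q - P| * `|fx P|
  + `|Q - P| * `|ft P|);
  last by ring.
by rewrite !lerD// [leRHS]mulrC ler_wpM2l.
Qed.

Lemma continuous_assoc_poly (R : realType) (N : nat) (v : 'M[R]_N.+1) :
  {within Omega R, continuous (assoc_poly v)}.
Proof.
have [T TE] := chebT_horner R.
apply/subspace_continuousP => P OP.
pose F (Q : R * R) := \sum_(j < N.+1) \sum_(k < N.+1)
   cheb_coef v j k * (T j).[Q.1] * (T k).[Q.2].
have FE Q : Omega R Q -> assoc_poly v Q = F Q.
  move=> [Q1 Q2]; apply: eq_bigr => j _; apply: eq_bigr => k _.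
  by rewrite !TE.
have cF : F Q @[Q --> within (Omega R) (nbhs P)] --> F P.
  apply: cvg_within_filter.
  apply: (cvg_big add_continuous) => j _.
  apply: (cvg_big add_continuous) => k _.
  apply: cvgM; first apply: cvgM; first exact: cvg_cst.
    apply: (@continuous_comp _ _ _ fst (horner (T j))).
      exact: cvg_fst.
    exact: continuous_horner.
  apply: (@continuous_comp _ _ _ snd (horner (T k))).
    exact: cvg_snd.
  exact: continuous_horner.
rewrite /from_subspace FE//; apply: cvg_trans cF; apply: near_eq_cvg.
by rewrite near_withinE; apply: nearW => Q OQ; rewrite FE.
Qed.

(** The angles n pi / N are spaced by pi / N, and cos is 1-Lipschitz.         *)
Lemma node_dense (R : realType) (N : nat) (x : R) : (0 < N)%N -> I11 R x ->
  exists n : 'I_N.+1, `|x - node R N n| <= pi / N%:R.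
Proof.
move=> N0 Ix; have /I11P xI := Ix.
have N0' : 0 < N%:R :> R by rewrite ltr0n.
have [a0 api] := (acos_ge0 xI, acos_lepi xI).
have cl (y z : R) : `|cos y - cos z| <= `|y - z|.
  wlog yz : y z / y <= z.
    move=> H; have [|/ltW zy] := leP y z; first exact: H.
    by rewrite distrC [leRHS]distrC; exact: H.
  have [c _ cE] := MVT_segment yz (fun x _ => is_derive_cos x)
    (continuous_subspaceT (@continuous_cos R)).
  rewrite distrC cE [leRHS]distrC normrM normrN ler_piMl//.
  exact: sin_max.
have q0 : 0 <= acos x * N%:R / pi by rewrite divr_ge0 ?mulr_ge0 ?pi_ge0.
have /andP[n1 n2] := truncn_itv q0.
set n := Num.truncn _ in n1 n2.
have nN : (n < N.+1)%N.
  rewrite ltnS -(ler_nat R) (le_trans n1)// ler_pdivrMr ?pi_gt0//.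
  by rewrite mulrC ler_wpM2l.
exists (Ordinal nN); rewrite /node /= -[X in `|X - _|](acosK xI).
apply: le_trans (cl _ _) _.
have -> : acos x - n%:R * pi / N%:R =
    (acos x * N%:R / pi - n%:R) * (pi / N%:R).
  by move: (acos x) (@pi R) (pi_gt0 R) => y z z0; field; rewrite !gt_eqF.
rewrite normrM ger0_norm ?subr_ge0// [`|pi / _|]ger0_norm; last first.
  by rewrite divr_ge0 ?pi_ge0.
rewrite ler_piMl ?divr_ge0 ?pi_ge0//.
by move: n2; rewrite -natr1; lra.
Qed.

Lemma node_I11 (R : realType) (N n : nat) : I11 R (node R N n).
Proof. by apply/I11P; rewrite /node cos_geN1 cos_le1. Qed.

(** * Functions that are twice differentiable in time *)

(** Fixing x keeps the whole argument about t one-dimensional.                *)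
Definition twice_dt (R : realType) (f : R * R -> R) (x : R) : Prop :=
  has_dI (fun s => f (x, s)) (fun s => dt f (x, s)) /\
  has_dI (fun s => dt f (x, s)) (fun s => dt (dt f) (x, s)).

Lemma twice_dt_bound (R : realType) (f g : R * R -> R) (x M : R) :
  twice_dt f x -> twice_dt g x ->
  (forall s, I11 R s -> `|dt (dt f) (x, s) - dt (dt g) (x, s)| <= M) ->
  forall t, I11 R t ->
  `|f (x, t) - g (x, t)| <= `|f (x, -1) - g (x, -1)|
    + 2 * `|dt f (x, -1) - dt g (x, -1)| + 4 * M.
Proof.
move=> [f1 f2] [g1 g2] HM t It.
exact: (has_dI2_bound (has_dIB f1 g1) (has_dIB f2 g2)).
Qed.

Lemma horner_section (R : realType) (f : R * R -> R) (x : R) (q : {poly R}) :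
  (forall s, I11 R s -> f (x, s) = q.[s]) ->
  [/\ twice_dt f x, forall s, I11 R s -> dt f (x, s) = q^`().[s] &
      forall s, I11 R s -> dt (dt f) (x, s) = q^`()^`().[s]].
Proof.
move=> fq.
have h1 : has_dI (fun s => f (x, s)) (horner q^`()).
  by apply: (eq_has_dI _ _ (@has_dI_horner R q)) => // s Is; rewrite fq.
have d1 s : I11 R s -> dt f (x, s) = q^`().[s] by exact: has_dI_uniq.
have h2 : has_dI (fun s => dt f (x, s)) (horner q^`()^`()).
  by apply: (eq_has_dI _ _ (@has_dI_horner R q^`())) => // s Is; rewrite d1.
have d2 s : I11 R s -> dt (dt f) (x, s) = q^`()^`().[s] by exact: has_dI_uniq.
split=> //; split.
  by apply: (eq_has_dI _ _ h1) => // s Is; rewrite d1.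
by apply: (eq_has_dI _ _ h2) => // s Is; rewrite d2.
Qed.

Lemma twice_dt_assoc_poly (R : realType) (N : nat) (v : 'M[R]_N.+1) (x : R) :
  I11 R x -> twice_dt (assoc_poly v) x.
Proof.
move=> Ix; have [T TE] := chebT_horner R.
pose q := \sum_(j < N.+1) \sum_(k < N.+1) (cheb_coef v j k * (T j).[x]) *: T k.
have [] // := @horner_section R (assoc_poly v) x q.
move=> s Is; rewrite /q horner_sum; apply: eq_bigr => j _.
by rewrite horner_sum; apply: eq_bigr => k _; rewrite hornerZ !TE.
Qed.

Lemma peridynamic_twice_dt (R : realType) (C u0 v0 : R -> R) (u : R * R -> R)
    (x : R) : peridynamic_solution C u0 v0 u -> I11 R x -> twice_dt u x.
Proof.
move=> [_ H _ _ _] Ix; split; apply: derivableI_has_dI => t It.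
  exact: (H x t Ix It).1.
exact: (H x t Ix It).2.
Qed.

(** * The approximation by iterated integrals *)

(** The antiderivative that vanishes at -1: with this constant the iterated
    integrals from -1 are again polynomials of this form.  The constant term of
    q is p`_0 / 0, which is 0 by the convention for division.                 *)
Definition antideriv (R : realType) (p : {poly R}) : {poly R} :=
  let q := \poly_(i < (size p).+1) (p`_i.-1 / i%:R) in q - q.[-1]%:P.

Lemma deriv_antideriv (R : realType) (p : {poly R}) : (antideriv p)^`() = p.
Proof.
apply/polyP => i; rewrite /antideriv derivB derivC subr0 coef_deriv coef_poly.
rewrite ltnS; case: ltnP => ip; last by rewrite mul0rn nth_default.
by rewrite /= -[LHS]mulr_natr divfK// pnatr_eq0.
Qed.

Lemma antideriv_N1 (R : realType) (p : {poly R}) : (antideriv p).[-1] = 0.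
Proof. by rewrite /antideriv hornerD hornerN hornerC subrr. Qed.

Lemma Rintegral_antideriv (R : realType) (p : {poly R}) (t : R) : -1 <= t ->
  \int[@lebesgue_measure R]_(s in [set` `[-1, t]]) p.[s] = (antideriv p).[t].
Proof.
rewrite le_eqVlt => /predU1P[<-|t1].
  by rewrite set_itv1 Rintegral_set1 antideriv_N1.
have cq (q : {poly R}) : continuous (horner q) by exact: continuous_horner.
rewrite /Rintegral (@continuous_FTC2 _ _ (horner (antideriv p)))//.
- by rewrite antideriv_N1 sube0.
- exact: continuous_subspaceT.
- split; first by move=> s _; exact: derivable_horner.
    by apply: cvg_at_right_filter; exact: cq.
  by apply: cvg_at_left_filter; exact: cq.
- move=> s _; rewrite derive1E (@derive_val _ _ _ _ _ _ _ (is_derive_poly _ _)).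
  by rewrite deriv_antideriv.
Qed.

(** Evaluating the coefficients at x first gives a polynomial in t alone.     *)
Lemma poly_xt_section (R : realType) (p : {poly {poly R}}) (x s : R) :
  poly_xt p (x, s) = (map_poly (horner_eval x) p).[s].
Proof.
have sE : horner_eval x s%:P = s by rewrite /horner_eval hornerC.
by rewrite -[in RHS]sE horner_map.
Qed.

Lemma utilde_section (R : realType) (u : R * R -> R) (p : {poly {poly R}})
    (x : R) : let q := map_poly (horner_eval x) p in
  forall t, I11 R t -> utilde u p (x, t) =
    ((u (x, -1))%:P + dt u (x, -1) *: ('X + 1) + antideriv (antideriv q)).[t].
Proof.
move=> q t /I11P /andP[t1 _].
transitivity (u (x, -1) + dt u (x, -1) * (t + 1) + (antideriv (antideriv q)).[t]).
  rewrite /utilde; congr (_ + _).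
  rewrite -Rintegral_antideriv//; apply: eq_Rintegral => s.
  rewrite inE /= in_itv /= => /andP[s1 _]; rewrite -Rintegral_antideriv//.
  by apply: eq_Rintegral => r _; rewrite poly_xt_section.
by move: (antideriv _) => A; rewrite !hornerE.
Qed.

(** u and utilde agree at t = -1 together with their first time derivative,
    and their second time derivatives are dt (dt u) and p.                    *)
Lemma utilde_approx (R : realType) (u : R * R -> R) (p : {poly {poly R}})
    (x e : R) : I11 R x -> twice_dt u x ->
  (forall s, I11 R s -> `|dt (dt u) (x, s) - poly_xt p (x, s)| <= e) ->
  forall t, I11 R t -> `|u (x, t) - utilde u p (x, t)| <= 4 * e.
Proof.
move=> Ix u2 Hp t It.
have [w2 w1E w2E] := horner_section (utilde_section u p x).
have I1 : I11 R (-1) by apply/I11P; lra.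
have dE (a b : R) (r : {poly R}) :
    (a%:P + b *: ('X + 1) + r)^`() = b%:P + r^`().
  by rewrite !(derivD, derivZ, derivX, derivC) addr0 add0r alg_polyC.
have ddE (b : R) (r : {poly R}) : (b%:P + r)^`() = r^`().
  by rewrite derivD derivC add0r.
move: w1E w2E; rewrite !dE !ddE !deriv_antideriv => w1E w2E.
have le_e s : I11 R s ->
    `|dt (dt u) (x, s) - dt (dt (utilde u p)) (x, s)| <= e.
  by move=> Is; rewrite w2E// -poly_xt_section; exact: Hp.
apply: le_trans (twice_dt_bound u2 w2 le_e It) _.
rewrite w1E// hornerD hornerC antideriv_N1 addr0 subrr normr0 mulr0 addr0.
rewrite utilde_section// hornerD antideriv_N1 !hornerE.
by rewrite addNr mulr0 addr0 subrr normr0 add0r.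
Qed.

(** * Convergence of the interpolating polynomials *)

Lemma uniform_near (T : choiceType) (R : realType) (A : set T)
    (F : nat -> T -> R) (f : T -> R) (e : R) :
  {uniform A, F @ \oo --> f} -> 0 < e ->
  \forall i \near \oo, forall x, A x -> `|f x - F i x| <= e.
Proof.
move=> H e0.
have : nbhs (f : {uniform` A -> R}) [set h | forall x, A x -> `|f x - h x| <= e].
  apply/uniform_nbhs; exists [set xy | ball xy.1 e xy.2]; split.
    exact: (entourage_ball _ (PosNum e0)).
  by move=> h /= hA x Ax; apply: ltW; exact: hA.
by move/H.
Qed.

(** W (1 / (2N - 2)^2) <= W 1 by monotonicity, and the factor
    1 / (2N - 2)^2 is at most 1 / N.                                          *)
Lemma rate_cvg0 (R : realType) (W : R -> R) (L e : R) :
  modulus_of_continuity W -> 0 < L -> 0 < e ->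
  exists M : nat, forall N, (2 <= N)%N -> (M <= N)%N -> rate L W N <= e.
Proof.
move=> [[_ W0] Wle _ _ _] L0 e0.
exists (Num.truncn (L * W 1 / e)).+1 => N N2 MN.
have W1 : 0 <= W 1 by exact: W0.
have /andP[_ bnd] := truncn_itv (divr_ge0 (mulr_ge0 (ltW L0) W1) (ltW e0)).
have {}bnd : L * W 1 / e <= N%:R.
  by rewrite (le_trans (ltW bnd))// ler_nat.
rewrite ler_pdivrMr// in bnd.
have N2' : 2 <= N%:R :> R by rewrite ler_nat.
have sN : N%:R <= (2 * N%:R - 2) ^+ 2 :> R by nra.
have s1 : 1 <= (2 * N%:R - 2) ^+ 2 :> R by lra.
rewrite /rate; move: ((2 * N%:R - 2) ^+ 2) sN s1 => s sN s1.
have s0 : 0 < s by lra.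
rewrite mulrAC ler_pdivrMr//.
have : W (1 / s) <= W 1.
  by apply: Wle; rewrite ?divr_ge0 ?(ltW s0)// ler_pdivrMr// mul1r.
nra.
Qed.

(** The derivatives are relative to [-1, 1] and the convolutions truncate
    their argument to [-1, 1], so only values on Omega are seen.              *)
Lemma peridynamic_solution_ext (R : realType) (C u0 v0 : R -> R)
    (u w : R * R -> R) :
  (forall P, Omega R P -> w P = u P) ->
  peridynamic_solution C u0 v0 u -> peridynamic_solution C u0 v0 w.
Proof.
move=> wu sol; have [conv_u _ eqn init0 init1] := sol.
have I1 : I11 R (-1) by apply/I11P; lra.
have patch_eq k t : I11 R t ->
    (fun y => w (y, t) ^+ k) \_ (I11 R) = (fun y => u (y, t) ^+ k) \_ (I11 R).
  move=> It; apply/funext => y; rewrite !patchE; case: ifPn => // /set_mem Iy.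
  by rewrite wu.
have integrand_eq k t x : I11 R t -> conv_integrand C (fun y => w (y, t) ^+ k) x =
    conv_integrand C (fun y => u (y, t) ^+ k) x.
  by move=> It; apply/funext => y; rewrite /conv_integrand patch_eq.
have h1 x : I11 R x -> has_dI (fun s => w (x, s)) (fun s => dt u (x, s)).
  move=> Ix; apply: (eq_has_dI _ _ (peridynamic_twice_dt sol Ix).1) => // s Is.
  by rewrite wu.
have d1 x s : I11 R x -> I11 R s -> dt w (x, s) = dt u (x, s).
  by move=> Ix Is; exact: has_dI_uniq (h1 x Ix) Is.
have h2 x : I11 R x -> has_dI (fun s => dt w (x, s)) (fun s => dt (dt u) (x, s)).
  move=> Ix; apply: (eq_has_dI _ _ (peridynamic_twice_dt sol Ix).2) => // s Is.
  by rewrite d1.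
split.
- move=> x t Ix It k k3; rewrite /conv_exists integrand_eq//; exact: conv_u.
- move=> x t Ix It; split.
    exact: has_dI_derivableI (h1 x Ix) It.
  exact: has_dI_derivableI (h2 x Ix) It.
- move=> [x t] [/= Ix It].
  have -> : dt (dt w) (x, t) = dt (dt u) (x, t).
    exact: has_dI_uniq (h2 x Ix) It.
  have conv_eq k : Defs.conv C (fun y => w (y, t) ^+ k) x =
    Defs.conv C (fun y => u (y, t) ^+ k) x by rewrite /Defs.conv integrand_eq.
  by rewrite eqn// /periop wu// !conv_eq (conv_eq 1%N).
- by move=> x Ix; rewrite wu ?init0.
- by move=> x Ix; rewrite d1 ?init1.
Qed.

Lemma node_pair_dense (R : realType) (sigma : nat -> nat) (P : R * R) (d : R)
    (i0 : nat) :
  (forall i, (i <= sigma i)%N) -> (forall i, (0 < sigma i)%N) ->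
  Omega R P -> 0 < d ->
  exists i (n m : 'I_(sigma i).+1), (i0 <= i)%N /\
    `|P - (node R (sigma i) n, node R (sigma i) m)| < d.
Proof.
move=> sle s0 [IP1 IP2] d0.
pose i := maxn i0 (Num.truncn (pi / d)).+1.
have [n nP] := node_dense (s0 i) IP1; have [m mP] := node_dense (s0 i) IP2.
exists i, n, m; split; first exact: leq_maxl.
have small : pi / (sigma i)%:R < d.
  rewrite ltr_pdivrMr ?ltr0n// mulrC -ltr_pdivrMr//.
  have /andP[_ /lt_le_trans->//] := truncn_itv (divr_ge0 (pi_ge0 R) (ltW d0)).
  by rewrite ler_nat (leq_trans _ (sle i))// leq_maxr.
by rewrite [ltLHS]/Num.norm /= gt_max (le_lt_trans nP)//= (le_lt_trans mP).
Qed.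

(** [twice_dt_bound] applied to the difference of two terms.  Each of the three
    limits is met within e / 14, so two terms differ by at most e / 7 in each
    component, and (1 + 2 + 4) e / 7 = e.                                     *)
Lemma assoc_poly_cauchy (R : realType) (N : nat -> nat)
    (v : forall i, 'M[R]_((N i).+1)) (phi1 phi2 : R -> R) (phi3 : R * R -> R)
    (e : R) :
  {uniform I11 R, (fun i x => assoc_poly (v i) (x, -1)) @ \oo --> phi1} ->
  {uniform I11 R, (fun i x => dt (assoc_poly (v i)) (x, -1)) @ \oo --> phi2} ->
  {uniform Omega R, (fun i => dt (dt (assoc_poly (v i)))) @ \oo --> phi3} ->
  0 < e ->
  exists M : nat, forall i k, (M <= i)%N -> (M <= k)%N ->
    forall P, Omega R P -> `|assoc_poly (v i) P - assoc_poly (v k) P| <= e.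
Proof.
move=> h1 h2 h3 e0; have e14 : 0 < e / 14 by lra.
have [M1 _ H1] := uniform_near h1 e14.
have [M2 _ H2] := uniform_near h2 e14.
have [M3 _ H3] := uniform_near h3 e14.
exists (maxn M1 (maxn M2 M3)) => i k; rewrite !geq_max.
move=> /and3P[i1 i2 i3] /and3P[k1 k2 k3] [x t] [/= Ix It].
have tri (a b c : R) : `|a - b| <= e / 14 -> `|a - c| <= e / 14 ->
    `|b - c| <= e / 7.
  by move=> ab ac; have := ler_distD a b c; rewrite (distrC b a); lra.
have b1 := tri _ _ _ (H1 i i1 x Ix) (H1 k k1 x Ix).
have b2 := tri _ _ _ (H2 i i2 x Ix) (H2 k k2 x Ix).
have b3 s : I11 R s -> `|dt (dt (assoc_poly (v i))) (x, s)
    - dt (dt (assoc_poly (v k))) (x, s)| <= e / 7.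
  by move=> Is; apply: tri (H3 i i3 (x, s) _) (H3 k k3 (x, s) _).
have := twice_dt_bound (twice_dt_assoc_poly _ Ix) (twice_dt_assoc_poly _ Ix)
  b3 It.
move=> /le_trans; apply; lra.
Qed.

Theorem theorem3 (R : realType)
  (delta : R) (hdelta : 0 < delta)
  (C : R -> R) (hC : micromodulus delta C)
  (W : R -> R) (hW : modulus_of_continuity W)
  (u0 v0 : R -> R) (u : R * R -> R)
  (hu : CkW W 2 u) (hsol : peridynamic_solution C u0 v0 u)
  (K : nat) (hK : (2 <= K)%N)
  (L : R) (hL : 0 < L)
  (p : nat -> {poly {poly R}})
  (hpdeg : forall N : nat, (K <= N)%N -> Pdeg (N - 2) N (p N))
  (hp : forall N : nat, (K <= N)%N ->
     (supnorm (fun P => (dt (dt u) P - poly_xt (p N) P)%R) <= (rate L W N)%:E)%E)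
  (ubar : forall N : nat, 'M[R]_N.+1)
  (hubar : forall N : nat, (K <= N)%N -> forall n m : 'I_N.+1,
     ubar N n m = utilde u (p N) (node R N n, node R N m))
  (hsys : forall N : nat, (K <= N)%N -> system_S W C u0 v0 (ubar N))
  (sigma : nat -> nat) (hsigma : forall i j : nat, (i < j)%N -> (sigma i < sigma j)%N)
  (hsigmaK : forall i : nat, (K <= sigma i)%N)
  (phi1 phi2 : R -> R) (phi3 : R * R -> R)
  (hphi1 : CkI 2 phi1) (hphi2 : CkI 2 phi2) (hphi3 : Ck 2 (Omega R) phi3)
  (hcvg1 : {uniform I11 R,
     (fun i : nat => (fun x : R => assoc_poly (ubar (sigma i)) (x, -1)))
       @ \oo --> phi1})
  (hcvg2 : {uniform I11 R,
     (fun i : nat => (fun x : R => dt (assoc_poly (ubar (sigma i))) (x, -1)))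
       @ \oo --> phi2})
  (hcvg3 : {uniform Omega R,
     (fun i : nat => dt (dt (assoc_poly (ubar (sigma i))))) @ \oo --> phi3}) :
  (forall P, Omega R P -> cvg (assoc_poly (ubar (sigma i)) P @[i --> \oo])) /\
  peridynamic_solution C u0 v0
    (fun P => lim (assoc_poly (ubar (sigma i)) P @[i --> \oo])).
Proof.
have sigma_ge i : (i <= sigma i)%N.
  by elim: i => // i IH; exact: leq_ltn_trans IH (hsigma _ _ (ltnSn i)).
have sigma_gt0 i : (0 < sigma i)%N.
  exact: leq_trans (leq_trans _ hK) (hsigmaK i).
have cu : {within Omega R, continuous u}.
  by have [[fx [ft [/gradient_on_continuous]]]] := hu.
have node_near e : 0 < e -> exists M : nat, forall i, (M <= i)%N ->
    forall n m : 'I_(sigma i).+1,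
    `|u (node R (sigma i) n, node R (sigma i) m) -
      assoc_poly (ubar (sigma i)) (node R (sigma i) n, node R (sigma i) m)| <= e.
  move=> e0; have e4 : 0 < e / 4 by lra.
  have [M HM] := rate_cvg0 hW hL e4.
  exists M => i Mi n m.
  rewrite assoc_poly_node// hubar//.
  have [In Im] := (node_I11 R (sigma i) n, node_I11 R (sigma i) m).
  have -> : e = 4 * (e / 4) by field.
  apply: (utilde_approx In (peridynamic_twice_dt hsol In)) => // s Is.
  apply: le_trans (HM _ (leq_trans hK (hsigmaK i)) (leq_trans Mi (sigma_ge i))).
  rewrite -lee_fin; apply: le_trans (hp _ (hsigmaK i)).
  by apply: ereal_sup_ubound; exists (node R (sigma i) n, s).
have cvg_u P : Omega R P -> assoc_poly (ubar (sigma i)) P @[i --> \oo] --> u P.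
  move=> OP; apply/cvgrPdist_le => e e0; have e4 : 0 < e / 4 by lra.
  have [M HM] := assoc_poly_cauchy hcvg1 hcvg2 hcvg3 e4.
  have [M' HM'] := node_near _ e4.
  exists M => // k /= Mk.
  have [d1 d10 near_u] := within_continuous_dist cu OP e4.
  have [d2 d20 near_f] :=
    within_continuous_dist (@continuous_assoc_poly _ _ (ubar (sigma k))) OP e4.
  have d0 : 0 < Num.min d1 d2 by rewrite lt_min d10.
  (* k is fixed; i may be larger than k, since it has to bring a node close to
     P at a scale that depends on the continuity of the k-th polynomial. *)
  have [i [n [m [ik]]]] := node_pair_dense (maxn M M') sigma_ge sigma_gt0 OP d0.
  rewrite geq_max in ik; have /andP[iM iM'] := ik.
  have OQ : Omega R (node R (sigma i) n, node R (sigma i) m).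
    by split; exact: node_I11.
  have := HM' i iM' n m.
  move: (node R (sigma i) n, node R (sigma i) m) OQ => Q OQ uf.
  rewrite lt_min => /andP[PQ1 PQ2].
  have b1 := near_u Q OQ PQ1; have b2 := near_f Q OQ PQ2.
  have b3 := HM i k iM Mk Q OQ.
  have t1 := ler_distD (u Q) (u P) (assoc_poly (ubar (sigma k)) P).
  have t2 := ler_distD (assoc_poly (ubar (sigma i)) Q) (u Q)
    (assoc_poly (ubar (sigma k)) P).
  have t3 := ler_distD (assoc_poly (ubar (sigma k)) Q)
    (assoc_poly (ubar (sigma i)) Q) (assoc_poly (ubar (sigma k)) P).
  rewrite [X in _ <= _ + X]distrC in t3.
  lra.
split; first by move=> P OP; apply/cvg_ex; exists (u P); exact: cvg_u.
apply: peridynamic_solution_ext hsol => P OP.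
by apply: cvg_lim => //; exact: cvg_u.
Qed.
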